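(* Let $\mathbb{F}=\mathbb{F}(n)$ be any field (finite or infinite, possibly depending on $n$) and let $p=p(n)$ satisfy $n^{-1}\le p\le 1$. Then with probability tending to $1$ as $n\to\infty$, $$\operatorname{minrank}_{\mathbb{F}}(G(n,p))\ \ge\ \frac{n\log(1/p)}{80\log n}.$$
   Context: For a graph $G$ on vertex set $[n]=\{1,\dots,n\}$ and a field $\mathbb{F}$, $\operatorname{minrank}_{\mathbb{F}}(G)$ is the minimum rank of a matrix $M\in\mathbb{F}^{n\times n}$ with all diagonal entries nonzero such that $M_{i,j}=0$ whenever $i\neq j$ and $i,j$ are nonadjacent in $G$. $G(n,p)$ denotes the binomial random graph on $[n]$ in which each pair is an edge independently with probability $p$. The logarithms are taken in the same base (the ratio $\log(1/p)/\log n$ does not depend on the base). *)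

(* Defs.v *)
From Stdlib Require Import Reals ClassicalEpsilon.
From HB Require Import structures.
From mathcomp Require Import all_boot all_order all_algebra.

Set Implicit Arguments.
Unset Strict Implicit.
Unset Printing Implicit Defensive.
Import GRing.Theory.

Definition pairs (n : nat) : {set 'I_n * 'I_n} :=
  [set e : 'I_n * 'I_n | (e.1 < e.2)%N].

(* A graph on [n] is encoded by its edge set E, a subset of [pairs n]. *)
Definition adj (n : nat) (E : {set 'I_n * 'I_n}) (i j : 'I_n) : bool :=
  ((i, j) \in E) || ((j, i) \in E).

Definition fits (F : fieldType) (n : nat) (E : {set 'I_n * 'I_n})
  (M : 'M[F]_n) : Prop :=
  (forall i, M i i != 0%R) /\
  (forall i j, i != j -> ~~ adj E i j -> M i j = 0%R).

Definition has_fit_rank (F : fieldType) (n : nat) (E : {set 'I_n * 'I_n})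
  (k : nat) : bool :=
  if excluded_middle_informative
       (exists M : 'M[F]_n, fits E M /\ \rank M = k)
  then true else false.

Lemma has_fit_rank_ex (F : fieldType) (n : nat) (E : {set 'I_n * 'I_n}) :
  exists k, has_fit_rank F E k.
Proof.
exists n; rewrite /has_fit_rank.
case: excluded_middle_informative => // H; exfalso; apply: H.
exists ((1%:M)%R : 'M[F]_n); split; last exact: mxrank1.
split=> [i|i j Hij _]; rewrite !mxE ?eqxx ?oner_eq0 //.
by rewrite (negbTE Hij).
Qed.

Definition minrank (F : fieldType) (n : nat) (E : {set 'I_n * 'I_n}) : nat :=
  ex_minn (has_fit_rank_ex F E).

Local Open Scope R_scope.

Definition gnp_weight (n : nat) (p : R) (E : {set 'I_n * 'I_n}) : R :=
  pow p #|E| * pow (1 - p) (#|pairs n| - #|E|).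

Definition indicator (P : Prop) : R :=
  if excluded_middle_informative P then 1 else 0.

Definition gnp_prob (n : nat) (p : R) (P : {set 'I_n * 'I_n} -> Prop) : R :=
  foldr Rplus 0
    (map (fun E => gnp_weight p E * indicator (P E)) (enum (powerset (pairs n)))).

(* Main.v *)
Require Import Defs.
From Stdlib Require Import Reals Lra.
From mathcomp Require Import all_boot all_order all_algebra.
From mathcomp Require Import boolp Rstruct.
From mathcomp Require Import zify.

(* If a matrix M fitting G(n,p) has small rank, choose a principal submatrix A, on an index set of size m,
   minimizing rank/size; let k be its rank and s its number of nonzero entries. By minimality every set X
   of rows of A has rank at least k|X|/m, so a greedy row basis and a greedy column basis of A each contain
   at most ks/m nonzero entries. Let N <= 2ks/m be the number of nonzero entries on these k rows and columns.
   Up to a nonzero scalar, A = C adj(W) R, where C and R consist of the basis columns and rows and W is their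
   common k x k block, so the support of A is the zero pattern of n^2 polynomials of degree at most k+2 in N
   variables. By the argument of Ronyai, Babai and Ganapathy there are at most n^(9N) such supports, whereas
   each of them lies in the edge set with probability at most n^(-19N); a union bound concludes. *)

Set Implicit Arguments.
Unset Strict Implicit.
Unset Printing Implicit Defensive.
Import Order.TTheory GRing.Theory Num.Theory.
Local Open Scope ring_scope.

(** * Zero patterns of polynomials *)

Definition mon (F : fieldType) (N : nat) (a : 'I_N -> nat) (x : 'I_N -> F) : F :=
  \prod_l x l ^+ a l.

(** [D] bounds the degree in each variable separately. The index set [I] may repeat monomials, so
    sums and products need only disjoint unions and products of index sets. *)
Definition poly_fun (F : fieldType) (N D : nat) (h : ('I_N -> F) -> F) : Prop :=
  exists (I : finType) (c : I -> F) (a : I -> 'I_N -> nat),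
    (forall i l, (a i l <= D)%N) /\ (forall x, h x = \sum_i c i * mon (a i) x).

Section PolyFun.
Variables (F : fieldType) (N : nat).
Implicit Types (h : ('I_N -> F) -> F) (D : nat).

Lemma poly_fun_ext D h h' : h =1 h' -> poly_fun D h -> poly_fun D h'.
Proof.
move=> e [I [c [a [ha hh]]]]; exists I, c, a; split=> // x.
by rewrite -e hh.
Qed.

Lemma poly_fun_le D D' h : (D <= D')%N -> poly_fun D h -> poly_fun D' h.
Proof.
move=> le [I [c [a [ha hh]]]]; exists I, c, a; split=> // i l.
exact: leq_trans (ha i l) le.
Qed.

Lemma poly_fun_cst D (c : F) : poly_fun D (fun _ : 'I_N -> F => c).
Proof.
exists 'I_1, (fun=> c), (fun _ _ => 0%N); split=> // x.
by rewrite big_ord1 /mon big1 ?mulr1 // => l _; rewrite expr0.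
Qed.

Lemma poly_fun_var (l : 'I_N) : poly_fun 1 (fun x : 'I_N -> F => x l).
Proof.
exists 'I_1, (fun=> 1), (fun _ l' => (l' == l : nat)); split=> [i l'|x].
  by case: (l' == l).
rewrite big_ord1 mul1r /mon (bigD1 l) //= eqxx expr1 big1 ?mulr1 // => l' /negPf ->.
by rewrite expr0.
Qed.

Lemma poly_funD D h h' : poly_fun D h -> poly_fun D h' ->
  poly_fun D (fun x => h x + h' x).
Proof.
move=> [I [c [a [ha hh]]]] [I' [c' [a' [ha' hh']]]].
exists (I + I')%type, (fun i => match i with inl i => c i | inr i => c' i end),
  (fun i => match i with inl i => a i | inr i => a' i end).
split=> [[i|i] l //|x]; by rewrite big_sumType hh hh'.
Qed.

Lemma poly_funM D D' h h' : poly_fun D h -> poly_fun D' h' ->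
  poly_fun (D + D') (fun x => h x * h' x).
Proof.
move=> [I [c [a [ha hh]]]] [I' [c' [a' [ha' hh']]]].
exists (I * I')%type, (fun i => c i.1 * c' i.2), (fun i l => (a i.1 l + a' i.2 l)%N).
split=> [i l|x]; first by rewrite leq_add.
rewrite hh hh' big_distrlr /= pair_big; apply: eq_bigr => i _ /=.
rewrite mulrACA; congr (_ * _); rewrite /mon -big_split /=.
by apply: eq_bigr => l _; rewrite exprD.
Qed.

Lemma poly_fun_sum D (J : Type) (r : seq J) (P : pred J) (h : J -> ('I_N -> F) -> F) :
  (forall j, poly_fun D (h j)) -> poly_fun D (fun x => \sum_(j <- r | P j) h j x).
Proof.
move=> hh; elim: r => [|j r ih].
  by apply: poly_fun_ext (poly_fun_cst _ 0) => x; rewrite big_nil.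
case: (boolP (P j)) => Pj.
  by apply: poly_fun_ext (poly_funD (hh j) ih) => x; rewrite big_cons Pj.
by apply: poly_fun_ext ih => x; rewrite big_cons (negPf Pj).
Qed.

Lemma poly_fun_prod D (J : finType) (P : pred J) (h : J -> ('I_N -> F) -> F) :
  (forall j, poly_fun D (h j)) -> poly_fun (#|J| * D) (fun x => \prod_(j | P j) h j x).
Proof.
move=> hh; rewrite cardE -[X in (X * D)%N]/(size (enum J)).
have -> : enum J = index_enum J by rewrite enumT.
elim: (index_enum J) => [|j r ih].
  by apply: poly_fun_ext (poly_fun_cst _ 1) => x; rewrite big_nil.
rewrite /= mulSn; case: (boolP (P j)) => Pj.
  by apply: poly_fun_ext (poly_funM (hh j) ih) => x; rewrite big_cons Pj.
apply: (poly_fun_le (leq_addl _ _)).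
by apply: poly_fun_ext ih => x; rewrite big_cons (negPf Pj).
Qed.

Lemma poly_fun_det D m (A : ('I_N -> F) -> 'M[F]_m) :
  (forall i j, poly_fun D (fun x => A x i j)) -> poly_fun (m * D) (fun x => \det (A x)).
Proof.
move=> hA; apply: poly_fun_sum => s; rewrite -[(m * D)%N]add0n.
apply: poly_funM; first exact: poly_fun_cst.
rewrite -[X in (X * D)%N]card_ord; exact: poly_fun_prod.
Qed.

Lemma poly_fun_adj D m (A : ('I_N -> F) -> 'M[F]_m) i j :
  (forall i j, poly_fun D (fun x => A x i j)) -> poly_fun (m * D) (fun x => (\adj (A x)) i j).
Proof.
move=> hA; have := poly_fun_det (A := fun x => row' j (col' i (A x))) (D := D).
move=> H.
apply: (poly_fun_le (D := (0 + m.-1 * D)%N)); first by rewrite add0n leq_mul2r leq_pred orbT.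
apply: (@poly_fun_ext _ (fun x => (-1) ^+ (j + i) * \det (row' j (col' i (A x))))).
  by move=> x; rewrite mxE.
apply: poly_funM; first exact: poly_fun_cst.
apply: H => i' j'; apply: poly_fun_ext (hA (lift j i') (lift i j')) => x.
by rewrite !mxE.
Qed.

Lemma poly_fun_mulmx D D' m n q (A : ('I_N -> F) -> 'M[F]_(m, n)) (B : ('I_N -> F) -> 'M[F]_(n, q)) i j :
  (forall i j, poly_fun D (fun x => A x i j)) ->
  (forall i j, poly_fun D' (fun x => B x i j)) ->
  poly_fun (D + D') (fun x => (A x *m B x) i j).
Proof.
move=> hA hB; apply: (@poly_fun_ext _ (fun x => \sum_k A x i k * B x k j)).
  by move=> x; rewrite mxE.
by apply: poly_fun_sum => k; apply: poly_funM.
Qed.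

(** Collecting equal monomials leaves one coefficient for each of the [D.+1 ^ N] exponent vectors;
    this dimension is what bounds the number of zero patterns. *)
Lemma poly_fun_coef D h : poly_fun D h ->
  exists c : {ffun 'I_N -> 'I_D.+1} -> F, forall x, h x = \sum_a c a * mon (fun l => a l) x.
Proof.
move=> [I [c [a [ha hh]]]].
pose b i : {ffun 'I_N -> 'I_D.+1} := [ffun l => inord (a i l)].
exists (fun g => \sum_(i | b i == g) c i) => x.
rewrite hh (partition_big b predT) //=; apply: eq_bigr => g _.
rewrite big_distrl; apply: eq_bigr => i /eqP <-; congr (_ * _).
by apply: eq_bigr => l _; rewrite ffunE inordK // ltnS.
Qed.

(* A pattern T with witness u_T gives the product g_T of the h_j, j in T; g_T(u_T') is nonzero iff
   T is contained in T', so the g_T are linearly independent. *)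
Lemma card_zero_patterns D (J : finType) (h : J -> ('I_N -> F) -> F) (W : {set {set J}}) :
  (forall j, poly_fun D (h j)) ->
  (forall T, T \in W -> exists x, T = [set j | h j x != 0]) ->
  (#|W| <= (#|J| * D).+1 ^ N)%N.
Proof.
move=> hh hW.
have /choice [u hu] : forall T, exists x, T \in W -> T = [set j | h j x != 0].
  move=> T; case: (boolP (T \in W)) => [/hW [x ->]|_]; first by exists x.
  by exists (fun=> 0).
have /choice [c hc] : forall T : {set J}, exists c : {ffun 'I_N -> 'I_(#|J| * D).+1} -> F,
    forall x, \prod_(j in T) h j x = \sum_a c a * mon (fun l => a l) x.
  by move=> T; apply: poly_fun_coef; apply: poly_fun_prod.
pose K := ({ffun 'I_N -> 'I_(#|J| * D).+1} : finType).
pose w (i : 'I_#|W|) : {set J} := enum_val i.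
(* The values g_T(u_T') form the matrix [G *m V], coefficients times monomials at the witnesses, so
   its rank is at most the number of monomials. *)
pose G := \matrix_(i < #|W|, j < #|K|) c (w i) (enum_val j).
pose V := \matrix_(j < #|K|, i < #|W|) mon (fun l => (enum_val j : K) l) (u (w i)).
have GV i i' : (G *m V) i i' = \prod_(j in w i) h j (u (w i')).
  rewrite hc mxE (reindex (@enum_val K predT)) /=; last first.
    by apply: onW_bij; apply: enum_val_bij.
  by apply: eq_bigr => a _; rewrite !mxE.
have wE i j : (j \in w i) = (h j (u (w i)) != 0).
  by rewrite {1}[w i]hu ?inE //; exact: enum_valP.
have GV0 i i' : ((G *m V) i i' != 0) = (w i \subset w i').
  rewrite GV; apply/idP/idP => [/prodf_neq0 H|/subsetP H].
    by apply/subsetP => j /H; rewrite wE.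
  by apply/prodf_neq0 => j /H; rewrite wE.
have free : row_free (G *m V).
  rewrite -kermx_eq0; apply/rowV0P => v /sub_kermxP v0.
  apply/eqP/negPn/negP => /rV0Pn [i0 vi0].
  (* In a linear relation [v], take a smallest pattern with nonzero coefficient and evaluate at its
     witness: another term survives only if its pattern is contained in this one, which minimality
     turns into equality. *)
  have [i vi imin] := arg_minnP (fun i => #|w i|) (P := fun i => v ord0 i != 0) vi0.
  have /matrixP/(_ ord0 i) := v0; rewrite [in RHS]mxE [LHS]mxE (bigD1 i) //= big1 ?addr0.
    move/eqP; rewrite mulf_eq0 (negPf vi) /= => /eqP e.
    by have := GV0 i i; rewrite e eqxx subxx.
  move=> i' ne; apply/eqP; rewrite mulf_eq0; case: eqP => //= /eqP vi'.
  apply/negPn/negP; rewrite GV0 => sub.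
  have /eqP/enum_val_inj e : w i' == w i by rewrite eqEcard sub imin.
  by rewrite e eqxx in ne.
have : (\rank (G *m V) <= #|K|)%N := leq_trans (mxrankM_maxl _ _) (rank_leq_col _).
by rewrite (eqP free) card_ffun !card_ord.
Qed.

End PolyFun.

(** * Patterns of matrices with sparse bases *)

Definition supp (F : fieldType) (n : nat) (A : 'M[F]_n) : {set 'I_n * 'I_n} :=
  [set e | A e.1 e.2 != 0].

(* Uses the adjugate of W instead of its inverse, so that the entries are polynomials in those of A. *)
Lemma rank_factor (F : fieldType) n k (A : 'M[F]_n) (f g : 'I_k -> 'I_n) :
  \rank A = k -> (A <= rowsub f A)%MS -> (A^T <= rowsub g A^T)%MS ->
  let W := mxsub f g A in
  \det W != 0 /\ colsub g A *m \adj W *m rowsub f A = \det W *: A.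
Proof.
move=> rA /submxP [P AP] /submxP [Q AQ] W.
have AQ' : A = colsub g A *m Q^T.
  by rewrite -[LHS]trmxK {1}AQ trmx_mul -[in LHS](trmx_mxsub id g) trmxK.
have WR : rowsub f A = W *m Q^T.
  by rewrite {1}AQ' -mul_rowsub_mx; congr (_ *m _); apply/matrixP => i j; rewrite !mxE.
have CW : colsub g A = P *m W.
  by apply/matrixP => i j; rewrite mxE {1}AP !mxE; apply: eq_bigr => l _; rewrite !mxE.
(* Here [A] = P W Q^T, so k = rank A is at most the rank of the k x k matrix [W]. *)
have uW : W \in unitmx.
  rewrite -row_free_unit /row_free eqn_leq rank_leq_row -{1}rA {1}AP WR.
  by rewrite (leq_trans (mxrankM_maxr _ _)) // mxrankM_maxl.
split; first by rewrite unitmxE unitfE in uW.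
by rewrite CW -(mulmxA P) mul_mx_adj mul_mx_scalar -scalemxAl -AP.
Qed.

Definition sparse_mx (F : fieldType) n N (z : 'I_N -> 'I_n * 'I_n) (x : 'I_N -> F) : 'M[F]_n :=
  \matrix_(i, j) \sum_(l | z l == (i, j)) x l.

(** The left side of the identity in [rank_factor]. It reads only the rows [f] and the columns [g]
    of [B], so all other entries may be erased. *)
Definition cross_mx (F : fieldType) n k (f g : 'I_k -> 'I_n) (B : 'M[F]_n) : 'M[F]_n :=
  colsub g B *m \adj (mxsub f g B) *m rowsub f B.

(** The condition [k <= N] limits the choices of [f] and [g], and [k <= n] limits the degree of the
    entries. *)
Definition patterns (F : fieldType) (n N : nat) : {set {set 'I_n * 'I_n}} :=
  [set T | `[< exists k (f g : 'I_k -> 'I_n) (z : 'I_N -> 'I_n * 'I_n) (x : 'I_N -> F),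
    [/\ (k <= N)%N, (k <= n)%N & T = supp (cross_mx f g (sparse_mx z x))] >]].

Lemma card_bigcup_sum (I T : finType) (B : I -> {set T}) :
  (#|\bigcup_i B i| <= \sum_i #|B i|)%N.
Proof.
elim/big_rec2: _ => [|i s S _ le]; first by rewrite cards0.
by rewrite (leq_trans (leq_card_setU _ _)) // leq_add2l.
Qed.

Lemma card_bigcup_le (I T : finType) (B : I -> {set T}) m :
  (forall i, #|B i| <= m)%N -> (#|\bigcup_i B i| <= #|I| * m)%N.
Proof.
move=> hB; rewrite -sum_nat_const; apply: leq_trans (card_bigcup_sum B) _.
exact: leq_sum.
Qed.

Lemma poly_fun_cross (F : fieldType) n k N (f g : 'I_k -> 'I_n) (z : 'I_N -> 'I_n * 'I_n) i j :
  poly_fun (k + 2) (fun x : 'I_N -> F => cross_mx f g (sparse_mx z x) i j).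
Proof.
have hB i' j' : poly_fun 1 (fun x : 'I_N -> F => sparse_mx z x i' j').
  apply: (@poly_fun_ext _ _ _ (fun x => \sum_(l | z l == (i', j')) x l)).
    by move=> x; rewrite mxE.
  by apply: poly_fun_sum => l; apply: poly_fun_var.
rewrite (_ : (k + 2 = 1 + k * 1 + 1)%N); last by lia.
apply: poly_fun_mulmx => [i' j'|i' j']; last first.
  by apply: poly_fun_ext (hB (f i') j') => x; rewrite [RHS]mxE.
apply: poly_fun_mulmx => [i1 j1|i1 j1].
  by apply: poly_fun_ext (hB i1 (g j1)) => x; rewrite [RHS]mxE.
apply: poly_fun_adj => i2 j2.
by apply: poly_fun_ext (hB (f i2) (g j2)) => x; rewrite [RHS]mxE.
Qed.

Lemma leq_expl (m n e : nat) : (m <= n -> m ^ e <= n ^ e)%N.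
Proof. by move=> le; case: e => // e; rewrite leq_exp2r. Qed.

(** The exponent 9N is N + 4N + 4N: at most N+1 <= n^N values of k, at most n^k n^k n^(2N) <= n^(4N)
    choices of [f], [g], [z], and at most n^(4N) zero patterns for each choice. *)
Lemma card_patterns (F : fieldType) (n N : nat) : (3 <= n)%N ->
  (#|patterns F n N| <= n ^ (9 * N))%N.
Proof.
move=> n3.
pose Q k (f g : {ffun 'I_k -> 'I_n}) (z : {ffun 'I_N -> 'I_n * 'I_n}) :=
  [set T | (k <= n)%N && `[< exists x : 'I_N -> F, T = supp (cross_mx f g (sparse_mx z x)) >]].
have Qle k f g z : (#|@Q k f g z| <= n ^ (4 * N))%N.
  case: (leqP k n) => kn; last first.
    by rewrite (_ : Q _ _ _ _ = set0) ?cards0 //; apply/setP => T; rewrite !inE leqNgt kn.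
  apply: (@leq_trans ((#|{: 'I_n * 'I_n}| * (k + 2)).+1 ^ N)).
    apply: (@card_zero_patterns F N _ _ (fun e x => cross_mx f g (sparse_mx z x) e.1 e.2)).
      by move=> e; apply: poly_fun_cross.
    by move=> T; rewrite inE => /andP [_ /asboolP].
  rewrite expnM; apply: leq_expl; rewrite card_prod card_ord.
  (* Gives n^2(k+2)+1 <= n^2(n+3) <= n^4, which already fails for k = n = 2. *)
  have n1 : (n + 3 <= n * n)%N by nia.
  rewrite (_ : n ^ 4 = n * n * (n * n))%N; last by rewrite !expnS expn0; lia.
  by nia.
have sub : patterns F n N \subset
    \bigcup_(k < N.+1) \bigcup_(f : {ffun 'I_k -> 'I_n}) \bigcup_(g : {ffun 'I_k -> 'I_n})
      \bigcup_(z : {ffun 'I_N -> 'I_n * 'I_n}) Q k f g z.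
  apply/subsetP => T; rewrite inE => /asboolP [k [f [g [z [x [kN kn ->]]]]]].
  have kN' : (k < N.+1)%N by [].
  apply/bigcupP; exists (Ordinal kN') => //=.
  apply/bigcupP; exists (finfun f) => //; apply/bigcupP; exists (finfun g) => //.
  apply/bigcupP; exists (finfun z) => //; rewrite inE kn; apply/asboolP; exists x.
  congr supp.
  have -> : sparse_mx (finfun z) x = sparse_mx z x.
    by apply/matrixP => i j; rewrite !mxE; apply: eq_bigl => l; rewrite ffunE.
  rewrite /cross_mx; congr (_ *m \adj _ *m _).
  - by apply/matrixP => i j; rewrite !mxE; apply: eq_bigl => l; rewrite ffunE.
  - by apply/matrixP => i j; rewrite !mxE; apply: eq_bigl => l; rewrite !ffunE.
  - by apply/matrixP => i j; rewrite !mxE; apply: eq_bigl => l; rewrite ffunE.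
apply: leq_trans (subset_leq_card sub) _.
apply: (@leq_trans (#|'I_N.+1| * n ^ (8 * N))).
  apply: card_bigcup_le => k.
  apply: (@leq_trans (n ^ k * (n ^ k * ((n ^ 2) ^ N * n ^ (4 * N))))).
    have cf : #|{ffun 'I_k -> 'I_n}| = (n ^ k)%N by rewrite card_ffun !card_ord.
    rewrite -{1}cf; apply: card_bigcup_le => f; rewrite -{1}cf; apply: card_bigcup_le => g.
    have <- : #|{ffun 'I_N -> 'I_n * 'I_n}| = ((n ^ 2) ^ N)%N.
      by rewrite card_ffun card_prod !card_ord.
    exact: card_bigcup_le.
  rewrite -expnM -!expnD leq_pexp2l; [by []|by lia|].
  by have := ltn_ord k; lia.
rewrite card_ord (_ : 9 * N = N + 8 * N)%N; last by lia.
rewrite expnD leq_mul2r (leq_trans (ltn_expl N (ltnSn 1))) ?orbT //.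
by apply: leq_expl; apply: leq_trans n3.
Qed.

(** * Sparse bases *)

Definition rows_of (F : fieldType) n q (A : 'M[F]_(n, q)) (X : {set 'I_n}) : 'M[F]_(#|X|, q) :=
  rowsub enum_val A.

Lemma rows_ofP (F : fieldType) n q m (A : 'M[F]_(n, q)) (X : {set 'I_n}) (U : 'M[F]_(m, q)) :
  reflect (forall i, i \in X -> (row i A <= U)%MS) (rows_of A X <= U)%MS.
Proof.
apply: (iffP row_subP) => [H i iX|H l]; last by rewrite row_rowsub H ?enum_valP.
by have := H (enum_rank_in iX i); rewrite row_rowsub enum_rankK_in.
Qed.

Lemma row_sub_rows_of (F : fieldType) n q (A : 'M[F]_(n, q)) (X : {set 'I_n}) i :
  i \in X -> (row i A <= rows_of A X)%MS.
Proof. by move: i; apply/rows_ofP. Qed.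

Lemma rows_ofS (F : fieldType) n q (A : 'M[F]_(n, q)) (X Y : {set 'I_n}) :
  X \subset Y -> (rows_of A X <= rows_of A Y)%MS.
Proof. by move=> /subsetP XY; apply/rows_ofP => i /XY; apply: row_sub_rows_of. Qed.

(** The bound [#|B| <= \rank (rows_of A B)] expresses linear independence. A largest independent set
    between [B] and [X] spans [X], since a row outside its span could be added. *)
Lemma extend_basis (F : fieldType) n q (A : 'M[F]_(n, q)) (B X : {set 'I_n}) :
  B \subset X -> (#|B| <= \rank (rows_of A B))%N ->
  exists B' : {set 'I_n}, [/\ B \subset B', B' \subset X,
    (#|B'| <= \rank (rows_of A B'))%N & (rows_of A X <= rows_of A B')%MS].
Proof.
move=> BX indB.
pose P (C : {set 'I_n}) := [&& B \subset C, C \subset X & (#|C| <= \rank (rows_of A C))%N].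
have PB : P B by rewrite /P subxx BX indB.
have [C /and3P [BC CX indC] Cmax] := arg_maxnP (fun C : {set 'I_n} => #|C|) PB.
exists C; split=> //; apply/rows_ofP => i iX; apply/negPn/negP => iC.
have iNC : i \notin C by apply: contra iC; apply: row_sub_rows_of.
have /Cmax : P (i |: C).
  apply/and3P; split.
  - by rewrite (subset_trans BC) // subsetUr.
  - by rewrite subUset sub1set iX.
  rewrite [X in (X <= _)%N]cardsU1 iNC add1n (leq_ltn_trans indC) // rank_ltmx //.
  rewrite ltmxE rows_ofS ?subsetUr //=; apply: contra iC; apply: submx_trans.
  by rewrite row_sub_rows_of // setU11.
by rewrite cardsU1 iNC add1n /= ltnn.
Qed.

Lemma sum_layer_cake n (w : 'I_n -> nat) (X : {set 'I_n}) m : (forall i, w i <= m)%N ->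
  (\sum_(i in X) w i = \sum_(t < m) #|[set i in X | t < w i]|)%N.
Proof.
move=> wm; transitivity (\sum_(i in X) \sum_(t < m) (t < w i))%N.
  apply: eq_bigr => i _; rewrite -(big_mkord predT (fun t => (t < w i) : nat)).
  rewrite (big_cat_nat _ (n := w i)) //=.
  have -> : (\sum_(0 <= t < w i) (t < w i) = w i)%N.
    rewrite (eq_big_nat _ _ (F2 := fun=> 1%N)) ?sum_nat_const_nat ?subn0 ?muln1 //.
    by move=> t /andP [_ ->].
  rewrite big_nat_cond big1 ?addn0 //.
  by move=> t /andP [/andP [le _] _]; rewrite ltnNge le.
rewrite exchange_big; apply: eq_bigr => t _ /=.
rewrite -sum1_card [RHS](eq_bigl (fun i => (i \in X) && (t < w i)%N)); last by move=> i; rewrite inE.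
by rewrite big_mkcondr.
Qed.

(* The basis is greedy for the weight, so it contains a basis of each set [w <= t]; the proportion of its
   elements of weight at most t is then at least that of S. *)
Lemma light_basis (F : fieldType) n q (A : 'M[F]_(n, q)) (w : 'I_n -> nat) (S : {set 'I_n}) :
  (A <= rows_of A S)%MS ->
  (forall X : {set 'I_n}, X \subset S ->
     \rank A * #|X| <= #|S| * \rank (rows_of A X))%N ->
  exists f : 'I_(\rank A) -> 'I_n, (A <= rowsub f A)%MS /\
    (#|S| * \sum_l w (f l) <= \rank A * \sum_(i in S) w i)%N.
Proof.
move=> AS hS; set k := \rank A in hS *.
pose low t := [set i in S | (w i <= t)%N].
have lowS t : low t \subset S by apply/subsetP => i; rewrite inE => /andP [].
(* Extending a basis of [low t] to one of [low t.+1] only enlarges its trace on the earlier levels,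
   so the bounds for [u <= t] persist. *)
have basis t : exists B : {set 'I_n}, [/\ B \subset low t, (#|B| <= \rank (rows_of A B))%N,
    (rows_of A (low t) <= rows_of A B)%MS &
    forall u, (u <= t)%N -> (\rank (rows_of A (low u)) <= #|B :&: low u|)%N].
  have self t' (B : {set 'I_n}) : B \subset low t' -> (rows_of A (low t') <= rows_of A B)%MS ->
      (\rank (rows_of A (low t')) <= #|B :&: low t'|)%N.
    move=> Bl /mxrankS le; rewrite (setIidPl Bl); apply: leq_trans le _.
    exact: rank_leq_row.
  elim: t => [|t [B [Bl indB spB hB]]].
    have [||B [_ Bl indB spB]] := @extend_basis _ _ _ A set0 (low 0%N).
    - exact: sub0set.
    - by rewrite [X in (X <= _)%N]cards0.
    exists B; split=> // u; rewrite leqn0 => /eqP ->; exact: self.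
  have [||B' [BB' B'l indB' spB']] := @extend_basis _ _ _ A B (low t.+1).
  - apply: subset_trans Bl _; apply/subsetP => i; rewrite !inE => /andP [-> /=].
    by move/leqW.
  - exact: indB.
  exists B'; split=> // u; rewrite leq_eqVlt => /orP [/eqP ->|]; first exact: self.
  rewrite ltnS => /hB H; apply: leq_trans H _; apply: subset_leq_card; exact: setSI.
pose m := (\max_i w i)%N; have wm i : (w i <= m)%N by apply: leq_bigmax.
have lowm : low m = S by apply/setP => i; rewrite inE wm andbT.
have [B [Bl indB spB hB]] := basis m; rewrite lowm in Bl spB.
have spA : (A <= rows_of A B)%MS := submx_trans AS spB.
have cB : #|B| = k.
  apply/eqP; rewrite eqn_leq (leq_trans indB) ?mxrankS ?rowsub_sub //=.
  by rewrite (leq_trans (mxrankS spA)) // rank_leq_row.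
exists (fun l => enum_val (cast_ord (esym cB) l)); split.
  apply: submx_trans spA _; apply/rows_ofP => i iB.
  have /(congr1 (fun j => row j A)) := enum_rankK_in iB iB; rewrite /= => <-.
  rewrite -[enum_rank_in iB i](cast_ordK cB).
  by rewrite -(row_rowsub (fun l => enum_val (cast_ord (esym cB) l))) ?row_sub.
have -> : (\sum_l w (enum_val (cast_ord (esym cB) l)) = \sum_(i in B) w i)%N.
  transitivity (\sum_(l < #|B|) w (enum_val l))%N; last by rewrite [RHS]big_enum_val.
  rewrite [RHS](reindex (cast_ord (esym cB))) //=.
  by apply: onW_bij; exists (cast_ord cB) => l; apply: val_inj.
(* Level by level: k |S| splits into heavy and light parts, once along [B] and once along [S]. The
   light part of [B] is at least rank(low t) >= k |low t| / |S|, so its heavy part is at most k/|S|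
   times that of [S]. *)
rewrite !(sum_layer_cake _ wm) !big_distrr /=; apply: leq_sum => t _.
have split (X : {set 'I_n}) : X \subset S -> (#|[set i in X | t < w i]| + #|X :&: low t| = #|X|)%N.
  move=> /subsetP XS; rewrite -(cardsID [set i | (t < w i)%N] X); congr (_ + _)%N.
    by apply: eq_card => i; rewrite !inE.
  apply: eq_card => i; rewrite !inE -leqNgt; by case: (boolP (i \in X)) => [/XS ->|_]; rewrite ?andbF ?andbT.
have sB := split B Bl; have sS := split S (subxx _); rewrite (setIidPr (lowS t)) in sS.
have h1 := hB t (ltnW (ltn_ord t)); have h2 := hS _ (lowS t).
have h3 : (#|S| * \rank (rows_of A (low t)) <= #|S| * #|B :&: low t|)%N by rewrite leq_mul2l h1 orbT.
rewrite cB in sB.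
have e1 := mulnDr #|S| #|[set i in B | (t < w i)%N]| #|B :&: low t|.
have e2 := mulnDr k #|[set i in S | (t < w i)%N]| #|low t|.
rewrite sB in e1; rewrite sS in e2.
by rewrite -(leq_add2r (#|S| * #|B :&: low t|)) -e1 mulnC e2 leq_add2l (leq_trans h2).
Qed.

(* The submatrix is kept of size n x n, padded with zeros. *)
Definition principal (F : fieldType) n (S : {set 'I_n}) (M : 'M[F]_n) : 'M[F]_n :=
  \matrix_(i, j) (if (i \in S) && (j \in S) then M i j else 0).

Lemma tr_principal (F : fieldType) n (S : {set 'I_n}) (M : 'M[F]_n) :
  (principal S M)^T = principal S M^T.
Proof. by apply/matrixP => i j; rewrite !mxE andbC. Qed.

Lemma principal_sub_rows (F : fieldType) n (M : 'M[F]_n) (S : {set 'I_n}) :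
  (principal S M <= rows_of (principal S M) S)%MS.
Proof.
apply/row_subP => i; case: (boolP (i \in S)) => [|iS]; first exact: row_sub_rows_of.
by rewrite (_ : row i _ = 0) ?sub0mx //; apply/rowP => j; rewrite !mxE (negPf iS).
Qed.

(** Transfers the ratio condition from principal submatrices to sets of rows: [principal X M] arises
    from the rows [X] of [A] by erasing columns, which cannot raise the rank. *)
Lemma principal_light_basis (F : fieldType) n (M : 'M[F]_n) (S : {set 'I_n}) (w : 'I_n -> nat) k :
  let A := principal S M in
  \rank A = k ->
  (forall X : {set 'I_n}, X \subset S -> k * #|X| <= #|S| * \rank (principal X M))%N ->
  exists f : 'I_k -> 'I_n, (A <= rowsub f A)%MS /\
    (#|S| * \sum_l w (f l) <= k * \sum_(i in S) w i)%N.
Proof.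
move=> A <- hS; apply: light_basis => [|X XS]; first exact: principal_sub_rows.
apply: leq_trans (hS X XS) _; rewrite leq_mul2l; apply/orP; right.
pose B := \matrix_(i, j) (if i \in X then A i j else 0).
have BX : (B <= rows_of A X)%MS.
  apply/row_subP => i; case: (boolP (i \in X)) => iX.
    by rewrite (_ : row i B = row i A) ?row_sub_rows_of //; apply/rowP => j; rewrite !mxE iX.
  by rewrite (_ : row i B = 0) ?sub0mx //; apply/rowP => j; rewrite !mxE (negPf iX).
apply: leq_trans (mxrankS BX).
have -> : principal X M = B *m diag_mx (\row_j (j \in X)%:R).
  rewrite mul_mx_diag; apply/matrixP => i j; rewrite !mxE.
  case: (boolP (i \in X)) => iX; last by rewrite mul0r.
  case: (boolP (j \in X)) => jX; last by rewrite mulr0.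
  by rewrite !(subsetP XS) // mulr1.
exact: mxrankM_maxl.
Qed.

(** Take [S] minimizing r(S)/|S| over nonempty sets and clear denominators; the second clause is the
    comparison with the whole set. *)
Lemma exists_min_ratio (T : finType) (r : {set T} -> nat) : (0 < #|T|)%N ->
  exists S : {set T}, [/\ (0 < #|S|)%N, (r S * #|T| <= r [set: T] * #|S|)%N &
    forall X : {set T}, (r S * #|X| <= #|S| * r X)%N].
Proof.
move=> T0.
pose ratio (X : {set T}) : rat := (r X)%:R / (#|X|)%:R.
have PT : (0 < #|[set: T]|)%N by rewrite cardsT.
have [S S0 Smin] := Order.TotalTheory.arg_minP ratio (P := fun X : {set T} => (0 < #|X|)%N) PT.
have le (X : {set T}) : (r S * #|X| <= #|S| * r X)%N.
  case: (posnP #|X|) => [->|X0]; first by rewrite muln0.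
  have := Smin X X0; rewrite /ratio ler_pdivrMr ?ltr0n // mulrAC ler_pdivlMr ?ltr0n //.
  by rewrite -!natrM ler_nat mulnC [in X in (_ <= X)%N]mulnC mulnC.
exists S; split=> //; by rewrite -cardsT (leq_trans (le _)) // mulnC.
Qed.

Lemma card_rel_sum (I J : finType) (P : I -> J -> bool) :
  #|[set e : I * J | P e.1 e.2]| = (\sum_i #|[set j | P i j]|)%N.
Proof.
transitivity (\sum_i \sum_j P i j)%N.
  rewrite pair_big /= -sum1_card big_mkcond /=; apply: eq_bigr => e _.
  by rewrite inE; case: (P _ _).
apply: eq_bigr => i _; rewrite -sum1_card [RHS]big_mkcond /=; apply: eq_bigr => j _.
by rewrite inE; case: (P _ _).
Qed.

Lemma sparse_mx_enum (F : fieldType) n (A : 'M[F]_n) (Z : {set 'I_n * 'I_n}) i j :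
  sparse_mx (fun l : 'I_#|Z| => enum_val l) (fun l => A (enum_val l).1 (enum_val l).2) i j =
  if (i, j) \in Z then A i j else 0.
Proof.
rewrite mxE; case: ifP => ijZ.
  rewrite (big_pred1 (enum_rank_in ijZ (i, j))) ?enum_rankK_in // => l /=.
  apply/eqP/eqP => [e|->]; last by rewrite enum_rankK_in.
  by rewrite -[LHS](enum_valK_in ijZ) e.
by rewrite big_pred0 // => l; apply/eqP => e; have := enum_valP l; rewrite e ijZ.
Qed.

(** A column [j] in [S] is nonzero, and the rows [f] span, so some row [f l] is nonzero in column
    [j]; distinct columns give distinct elements of [Z]. *)
Lemma card_col_cover (F : fieldType) n (A : 'M[F]_n) k (f : 'I_k -> 'I_n) (S : {set 'I_n})
    (Z : {set 'I_n * 'I_n}) :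
  (A <= rowsub f A)%MS -> (forall i, i \in S -> A i i != 0) ->
  (forall l j, A (f l) j != 0 -> (f l, j) \in Z) -> (#|S| <= #|Z|)%N.
Proof.
move=> /submxP [P AP] dS hZ.
apply: (@leq_trans #|[set e.2 | e in Z]|); last exact: leq_imset_card.
apply: subset_leq_card; apply/subsetP => j jS.
case: (pickP (fun l => A (f l) j != 0)) => [l /hZ lZ|none].
  by apply/imsetP; exists (f l, j).
have /eqP := dS j jS; case; rewrite AP mxE big1 // => l _.
by have /negbFE /eqP e := none l; rewrite [rowsub _ _ _ _]mxE e mulr0.
Qed.

Lemma card_cross (F : fieldType) n (A : 'M[F]_n) k (f g : 'I_k -> 'I_n) (Z : {set 'I_n * 'I_n}) :
  Z = [set e | (A e.1 e.2 != 0) && ((e.1 \in codom f) || (e.2 \in codom g))] ->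
  (#|Z| <= \sum_l #|[set j | A (f l) j != 0%R]| + \sum_l #|[set i | A i (g l) != 0%R]|)%N.
Proof.
move=> ->.
pose R l := [set (f l, j) | j in [set j | A (f l) j != 0]].
pose C l := [set (i, g l) | i in [set i | A i (g l) != 0]].
apply: (@leq_trans #|\bigcup_l R l :|: \bigcup_l C l|).
  apply: subset_leq_card; apply/subsetP => -[i j]; rewrite !inE /=.
  move=> /andP [nz /orP [/codomP [l el]|/codomP [l el]]]; apply/orP; [left|right].
    apply/bigcupP; exists l => //; apply/imsetP; exists j; rewrite ?el // inE -el //.
  apply/bigcupP; exists l => //; apply/imsetP; exists i; rewrite ?el // inE -el //.
apply: leq_trans (leq_card_setU _ _) (leq_add _ _).
  apply: leq_trans (card_bigcup_sum _) _; apply: leq_sum => l _; exact: leq_imset_card.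
apply: leq_trans (card_bigcup_sum _) _; apply: leq_sum => l _; exact: leq_imset_card.
Qed.

(** The deterministic half. [T] is the support of the minimal principal submatrix; its index set is
    read off the diagonal of [T], because [M] has no zero on the diagonal. *)
Lemma sparse_pattern (F : fieldType) n (E : {set 'I_n * 'I_n}) (M : 'M[F]_n) :
  (0 < n)%N -> fits E M ->
  exists N (T : {set 'I_n * 'I_n}) k, let m := #|[set i | (i, i) \in T]| in
    [/\ T \in patterns F n N,
        forall i j, (i, j) \in T -> i != j -> adj E i j,
        (0 < m <= N)%N, (N <= n * n)%N &
        (N * m <= 2 * (k * #|T|))%N /\ (k * n <= \rank M * m)%N].
Proof.
move=> n0 [dM zM].
have [|S [S0 SM Smin]] := exists_min_ratio (fun X => \rank (principal X M)) (T := 'I_n).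
  by rewrite card_ord.
set A := principal S M in SM Smin; set k := \rank A in SM Smin.
have MT : principal [set: 'I_n] M = M by apply/matrixP => i j; rewrite mxE !inE.
rewrite card_ord MT in SM.
have AE i j : A i j = if (i \in S) && (j \in S) then M i j else 0 by rewrite mxE.
have dA i : (A i i != 0) = (i \in S) by rewrite AE andbb; case: (i \in S); rewrite ?dM ?eqxx.
have sumT : (\sum_(i in S) #|[set j | A i j != 0%R]| <= #|supp A|)%N.
  by rewrite /supp (card_rel_sum (fun i j => A i j != 0)) big_mkcond /=; apply: leq_sum => i _; case: ifP.
have sumTc : (\sum_(j in S) #|[set i | A i j != 0%R]| <= #|supp A|)%N.
  rewrite (_ : #|supp A| = #|supp A^T|).
    rewrite /supp (card_rel_sum (fun i j => A^T i j != 0)) big_mkcond /=; apply: leq_sum => i _.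
    by case: ifP => // _; apply: eq_leq; apply: eq_card => j; rewrite !inE [A^T _ _]mxE.
  have inj : injective (fun e : 'I_n * 'I_n => (e.2, e.1)).
    by move=> [a b] [c d] /= [-> ->].
  rewrite -(card_imset (supp A) inj); apply: eq_card => -[i j].
  apply/imsetP/idP => [[[i' j']]|]; rewrite !inE /= ?[A^T _ _]mxE.
    by move=> nz [-> ->].
  by move=> nz; exists (j, i); rewrite ?inE.
have [f [Af hf]] := principal_light_basis (fun i => #|[set j | A i j != 0]|) (erefl k) (fun X _ => Smin X).
have rkT : \rank (principal S M^T) = k by rewrite -tr_principal mxrank_tr.
(* A column basis of [A] is a row basis of its transpose. Transposition preserves the ranks of
   principal submatrices, so minimality of the ratio is inherited. *)
have minT (X : {set 'I_n}) : X \subset S -> (k * #|X| <= #|S| * \rank (principal X M^T))%N.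
  by rewrite -tr_principal mxrank_tr.
have [g [Ag hg]] := principal_light_basis (fun j => #|[set i | A i j != 0]|) rkT minT.
rewrite -tr_principal -/A in Ag.
pose Z := [set e | (A e.1 e.2 != 0) && ((e.1 \in codom f) || (e.2 \in codom g))].
have SZ : (#|S| <= #|Z|)%N.
  apply: (card_col_cover Af) => [i|l j nz]; first by rewrite dA.
  by rewrite inE /= nz codom_f.
have kS : (k <= #|S|)%N by apply: leq_trans (mxrankS (principal_sub_rows M S)) (rank_leq_row _).
exists #|Z|, (supp A), k; rewrite /=.
have -> : [set i | (i, i) \in supp A] = S by apply/setP => i; rewrite !inE dA.
split.
- rewrite inE; apply/asboolP.
  exists k, f, g, (fun l => enum_val l), (fun l => A (enum_val l).1 (enum_val l).2).
  split; [exact: leq_trans kS SZ|exact: rank_leq_row|].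
  set B := sparse_mx _ _.
  (* On these rows and columns, a position outside [Z] carries a zero of [A], which is also the
     default entry of [B]. *)
  have BE i j : (i \in codom f) || (j \in codom g) -> B i j = A i j.
    by rewrite sparse_mx_enum inE /= => ->; rewrite andbT; case: eqP => [->|].
  have [d0 dA'] := rank_factor (erefl k) Af Ag.
  have -> : cross_mx f g B = cross_mx f g A.
    rewrite /cross_mx; congr (_ *m \adj _ *m _); apply/matrixP => i j;
    by rewrite [LHS]mxE [RHS]mxE BE ?codom_f ?orbT.
  by rewrite /cross_mx dA'; apply/setP => -[i j]; rewrite !inE /= [(_ *: A) _ _]mxE mulf_eq0 negb_or d0.
- move=> i j; rewrite inE /= AE; case: ifP => [_ nz ij|]; last by rewrite eqxx.
  by apply/negPn/negP => /zM e; rewrite e ?eqxx in nz.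
- by rewrite S0 SZ.
- by rewrite (leq_trans (max_card _)) // card_prod card_ord.
split=> //.
(* N is at most the count [a] on the basis rows plus the count [b] on the basis columns, and m a and
   m b are each at most k times the size of the support. *)
have := card_cross (erefl Z).
set a := (\sum_l _)%N in hf *; set b := (\sum_l _)%N in hg * => le.
have h1 : (k * \sum_(i in S) #|[set j | A i j != 0%R]| <= k * #|supp A|)%N by rewrite leq_mul2l sumT orbT.
have h2 : (k * \sum_(j in S) #|[set i | A i j != 0%R]| <= k * #|supp A|)%N by rewrite leq_mul2l sumTc orbT.
rewrite mulnC (leq_trans (leq_mul (leqnn _) le)) // mulnDr mul2n -addnn.
by apply: leq_add; [apply: leq_trans hf h1|apply: leq_trans hg h2].
Qed.

(** * Probability estimates *)

(* The edges that a graph must contain to be fitted by a matrix of support T. *)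
Definition under (n : nat) (T : {set 'I_n * 'I_n}) : {set 'I_n * 'I_n} :=
  [set e in pairs n | (e \in T) || ((e.2, e.1) \in T)].

(** A position of [T] is diagonal or is one of the two orientations of an edge in [under T]. *)
Lemma card_le_under (n : nat) (T : {set 'I_n * 'I_n}) :
  (#|T| <= #|[set i | (i, i) \in T]| + 2 * #|under T|)%N.
Proof.
pose D := [set (i, i) | i in [set i | (i, i) \in T]].
pose U := [set (e.2, e.1) | e in under T].
apply: (@leq_trans #|D :|: (under T :|: U)|).
  apply: subset_leq_card; apply/subsetP => -[i j] ijT; rewrite !inE /=.
  case: (ltngtP i j) => [lt|gt|/val_inj e].
  - by rewrite ijT !orbT.
  - apply/orP; right; apply/orP; right; apply/imsetP; exists (j, i) => //.
    by rewrite !inE /= gt ijT orbT.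
  - by rewrite -e in ijT *; apply/orP; left; apply/imsetP; exists i; rewrite ?inE.
apply: leq_trans (leq_card_setU _ _) (leq_add (leq_imset_card _ _) _).
apply: leq_trans (leq_card_setU _ _) _; rewrite mul2n -addnn leq_add2l.
exact: leq_imset_card.
Qed.

Lemma under_subset (n : nat) (E T : {set 'I_n * 'I_n}) : E \subset pairs n ->
  (forall i j, (i, j) \in T -> i != j -> adj E i j) -> under T \subset E.
Proof.
move=> /subsetP EP h; apply/subsetP => -[i j]; rewrite !inE /= => /andP [lt inT].
have ne : i != j by rewrite neq_ltn lt.
have nE : (j, i) \notin E by apply/negP => /EP; rewrite inE /= ltnNge ltnW.
have : adj E i j || adj E j i.
  by case/orP: inT => /h -> //; rewrite ?orbT // eq_sym.
by rewrite /adj (negPf nE) !orbF orbb.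
Qed.

Lemma gnp_probE (n : nat) (p : R) (P : {set 'I_n * 'I_n} -> Prop) :
  gnp_prob p P = \sum_(E in powerset (pairs n)) gnp_weight p E * indicator (P E).
Proof.
rewrite -big_enum /= /gnp_prob; elim: (enum _) => [|E s ih]; first by rewrite big_nil.
by rewrite big_cons /= ih.
Qed.

(** Expand the product of [a e + b e], the weights of [e] being present and absent: absence is
    forbidden on [P], presence outside [pairs n]. *)
Lemma sum_gnp_weight_superset (n : nat) (p : R) (P : {set 'I_n * 'I_n}) : P \subset pairs n ->
  \sum_(E in powerset (pairs n)) gnp_weight p E * (P \subset E)%:R = p ^+ #|P|.
Proof.
move=> PP.
pose a e : R := if e \in pairs n then p else 0.
pose b e : R := if e \in pairs n then (if e \in P then 0 else 1 - p) else 1.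
transitivity (\prod_e (a e + b e)); last first.
  rewrite -prodr_const [RHS]big_mkcond /=; apply: eq_bigr => e _; rewrite /a /b.
  case: (boolP (e \in P)) => [/(subsetP PP) ->|_]; first by rewrite addr0.
  by case: (e \in pairs n); rewrite ?add0r // addrC subrK.
rewrite bigA_distr [LHS]big_mkcond /=; apply: eq_bigr => E _; rewrite powersetE.
case: (boolP (E \subset pairs n)) => [EP|/subsetPn [e eE eP]]; last first.
  by rewrite (bigD1 e) //= eE /a (negPf eP) mul0r.
case: (boolP (P \subset E)) => [PE|/subsetPn [e eP eE]]; last first.
  by rewrite mulr0 (bigD1 e) //= (negPf eE) /b (subsetP PP) // eP mul0r.
rewrite mulr1 /gnp_weight !RpowE (bigID (mem E)) /=; congr (_ * _).
  rewrite -prodr_const; apply: eq_bigr => e eE.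
  by rewrite eE /a (subsetP EP).
have -> : (#|pairs n| - #|E| = #|pairs n :\: E|)%N.
  by rewrite cardsD (setIidPr EP).
rewrite -prodr_const [LHS]big_mkcond [RHS]big_mkcond /=; apply: eq_bigr => e _.
rewrite !inE; case: (boolP (e \in E)) => //= eE; rewrite /b.
case: (boolP (e \in pairs n)) => eP; last by rewrite !inE in eP; rewrite (negPf eP).
rewrite inE in eP; rewrite eP; case: ifP => // /(subsetP PE) eE'; by rewrite eE' in eE.
Qed.

Lemma gnp_weight_ge0 (n : nat) (p : R) (E : {set 'I_n * 'I_n}) : 0 <= p <= 1 -> 0 <= gnp_weight p E.
Proof.
move=> /andP [p0 p1]; rewrite /gnp_weight !RpowE RmultE mulr_ge0 ?exprn_ge0 //.
by rewrite RminusE subr_ge0.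
Qed.

Lemma indicator_bool (P : Prop) : indicator P = `[< P >]%:R :> R.
Proof.
rewrite /indicator; case: ClassicalEpsilon.excluded_middle_informative => h.
  by rewrite asboolT.
by rewrite asboolF.
Qed.

Lemma gnp_prob_union_bound (n : nat) (p : R) (P : {set 'I_n * 'I_n} -> Prop)
  (I : finType) (D : I -> {set 'I_n * 'I_n}) (B : {set I}) :
  0 <= p <= 1 -> (forall i, D i \subset pairs n) ->
  (forall E : {set 'I_n * 'I_n}, E \subset pairs n -> ~ P E -> exists2 i, i \in B & D i \subset E) ->
  1 - \sum_(i in B) p ^+ #|D i| <= gnp_prob p P <= 1.
Proof.
move=> p01 Dp bad.
have tot : \sum_(E in powerset (pairs n)) gnp_weight p E = 1.
  (* Every graph contains the empty edge set, so the total mass is p^0 = 1. *)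
  have := sum_gnp_weight_superset p (sub0set (pairs n)); rewrite cards0 expr0 => <-.
  by apply: eq_bigr => E _; rewrite sub0set mulr1.
rewrite gnp_probE; apply/andP; split; last first.
  rewrite -[X in _ <= X]tot; apply: ler_sum => E _; rewrite indicator_bool.
  by rewrite ler_piMr ?gnp_weight_ge0 //; case: asbool.
rewrite lerBlDr -tot.
under [X in _ + X]eq_bigr => i _ do rewrite -(sum_gnp_weight_superset p (Dp i)).
rewrite exchange_big -big_split /=; apply: ler_sum => E; rewrite powersetE => EP.
rewrite -big_distrr -mulrDr indicator_bool /=.
(* Pointwise in [E], it remains that 1 is at most the indicator of [P E] plus the number of [i] in
   [B] with [D i] inside [E]. *)
rewrite ler_peMr ?gnp_weight_ge0 //.
have s0 (J : {set I}) : 0 <= \sum_(i in J) (D i \subset E)%:R :> R by apply: sumr_ge0 => i _; apply: ler0n.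
case: asboolP => [_|/(bad E EP) [i iB iE]]; first by rewrite lerDl.
rewrite add0r (bigD1 i) //= iE lerDl; apply: sumr_ge0 => j _; exact: ler0n.
Qed.

Lemma minrankP (F : fieldType) (n : nat) (E : {set 'I_n * 'I_n}) :
  exists2 M : 'M[F]_n, fits E M & \rank M = minrank F E.
Proof.
rewrite /minrank; case: ex_minnP => k + _; rewrite /has_fit_rank.
by case: ClassicalEpsilon.excluded_middle_informative => // -[M [fM rM]] _; exists M.
Qed.

(** * Numerical estimates and conclusion *)

Section RealEstimates.
Local Open Scope R_scope.

Lemma pow_le_of_ln (p x : R) (q r : nat) : (0 < p) -> (0 < x) ->
  (INR q * ln p <= INR r * ln x) -> (pow p q <= pow x r).
Proof.
move=> p0 x0 h; rewrite -!Rpower_pow // /Rpower.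
case: h => [h|->]; last exact: Rle_refl.
by apply: Rlt_le; apply: exp_increasing.
Qed.

(* Writing L = ln n and l = ln (1/p) <= L, one gets 40 N L <= l s from the bound on N, and
   l s <= l m + 2 l q <= N L + 2 l q from m <= N, hence l q >= 19.5 N L. *)
Lemma pattern_weight (p x : R) (n K k m s q N : nat) :
  (1 < x) -> x = INR n -> (/ x <= p) -> (p <= 1) ->
  (INR K < x * ln (/ p) / (80 * ln x)) ->
  (0 < m <= N)%N -> (N * m <= 2 * (k * s))%N -> (k * n <= K * m)%N -> (s <= m + 2 * q)%N ->
  (pow p q <= pow (/ x) (19 * N)).
Proof.
move=> x1 xn px p1 hK /andP [m0 mN] /ssrnat.leP/le_INR Nm /ssrnat.leP/le_INR kn /ssrnat.leP/le_INR sq.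
move: mN m0 => /ssrnat.leP/le_INR mN /ssrnat.ltP/lt_INR m0.
rewrite !(mult_INR, plus_INR) -?xn in Nm kn sq mN m0 *.
rewrite /= in Nm sq m0.
have x0 : (0 < x) by lra.
have ix0 : (0 < / x) by apply: Rinv_0_lt_compat.
have p0 : (0 < p) by lra.
have L0 : (0 < ln x) by rewrite -ln_1; apply: ln_increasing; lra.
rewrite ln_Rinv // in hK.
apply: pow_le_of_ln => //; rewrite ln_Rinv //.
have ln_le a b : 0 < a -> a <= b -> ln a <= ln b.
  by move=> a0 [lt|->]; [apply: Rlt_le; apply: ln_increasing|apply: Rle_refl].
have lp : (- ln p <= ln x).
  rewrite -ln_Rinv //; apply: ln_le; first exact: Rinv_0_lt_compat.
  by rewrite -(Rinv_inv x); apply: Rinv_le_contravar.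
have lp0 : (0 <= - ln p).
  by rewrite -ln_Rinv // -ln_1; apply: ln_le; [lra|rewrite -Rinv_1; apply: Rinv_le_contravar].
rewrite mult_INR (_ : INR 19 = 19); last by rewrite /=; lra.
set L := ln x in L0 lp hK *; set l := (- ln p) in lp lp0 hK *.
have -> : ln p = (- l) by rewrite /l; lra.
move: (INR K) (INR k) (INR m) (INR s) (INR q) (INR N) hK Nm kn sq mN m0 (pos_INR k) (pos_INR s).
move=> K' k' m' s' q' N' hK Nm kn sq mN m0 k0 s0.
have hK' : (80 * K' * L < x * l).
  have := Rmult_lt_compat_r (80 * L) _ _ ltac:(lra) hK.
  rewrite /Rdiv Rmult_assoc Rinv_l; [lra|nra].
(* Combine k n <= K m with 80 K L < n l and cancel n. *)
have h1 : (80 * k' * L <= l * m').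
  apply: (Rmult_le_reg_l x) => //; nra.
have h2 : (40 * N' * L <= l * s').
  apply: (Rmult_le_reg_l m') => //.
  have e1 : (40 * (N' * m') * L <= 40 * (2 * (k' * s')) * L) by nra.
  have e2 : (80 * k' * L * s' <= l * m' * s') by apply: Rmult_le_compat_r.
  nra.
have h3 : (l * s' <= l * (m' + 2 * q')) by apply: Rmult_le_compat_l => //; lra.
have h4 : (l * m' <= L * N') by nra.
nra.
Qed.

End RealEstimates.

(** For each N >= 1, n^(9N) patterns of weight n^(-19N) contribute at most n^(-10), and there are
    n^2+1 <= n^9 values of N. The weight bound is part of the index set because it is derived only
    for patterns coming from matrices of small rank. *)
Lemma sum_patterns_weight (F : fieldType) (n : nat) (p : R) : (3 <= n)%N -> 0 <= p ->
  \sum_(i in [set i : 'I_(n * n).+1 * {set 'I_n * 'I_n} |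
      [&& (0 < i.1)%N, i.2 \in patterns F n i.1 & p ^+ #|under i.2| <= n%:R^-1 ^+ (19 * i.1)]])
    p ^+ #|under i.2| <= n%:R^-1.
Proof.
move=> n3 p0.
have n0 : (0 : R) < n%:R by rewrite ltr0n; apply: leq_trans n3.
have n1 : (n%:R^-1 : R) <= 1 by rewrite invf_le1 // ler1n; apply: leq_trans n3.
have i0 : (0 : R) <= n%:R^-1 by rewrite invr_ge0 ltW.
apply: (@le_trans _ _ (\sum_(N < (n * n).+1) n%:R^-1 ^+ 10)); last first.
  rewrite sumr_const card_ord.
  apply: (@le_trans _ _ (n%:R^-1 ^+ 10 *+ (n ^ 9))).
    rewrite ler_wpMn2l ?exprn_ge0 //.
    apply: (@leq_trans (n ^ 3)); last by rewrite leq_exp2l // (leq_trans _ n3).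
    by rewrite !expnS expn0; nia.
  by rewrite -mulr_natr natrX exprS -mulrA -exprMn mulVf ?expr1n ?mulr1 // gt_eqF.
set B := [set i | _].
rewrite (_ : \sum_(i in B) _ =
  \sum_(N < (n * n).+1) \sum_T if (N, T) \in B then p ^+ #|under T| else 0); last first.
  by rewrite pair_bigA big_mkcond; apply: eq_bigr => -[].
apply: ler_sum => N _; rewrite -big_mkcond /=.
case: (posnP N) => [N0|N0].
  by rewrite big_pred0 ?exprn_ge0 // => T; rewrite inE N0.
apply: (@le_trans _ _ (\sum_(T in patterns F n N) n%:R^-1 ^+ (19 * N))).
  rewrite big_mkcond [X in _ <= X]big_mkcond /=; apply: ler_sum => T _; rewrite inE /= N0 /=.
  by case: (T \in _) => //=; case: ifP => // _; rewrite exprn_ge0.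
rewrite sumr_const.
apply: (@le_trans _ _ (n%:R^-1 ^+ (19 * N) *+ (n ^ (9 * N)))).
  by rewrite ler_wpMn2l ?exprn_ge0 // card_patterns.
rewrite (_ : 19 * N = 9 * N + 10 * N)%N; last by lia.
rewrite -mulr_natr natrX exprD mulrAC -exprMn mulVf ?gt_eqF // expr1n mul1r.
by rewrite ler_wiXn2l // leq_pmulr.
Qed.

Lemma gnp_prob_minrank (F : fieldType) (n : nat) (p : R) :
  (3 <= n)%N -> Rle (Rinv (INR n)) p -> Rle p (IZR 1) ->
  1 - n%:R^-1 <= gnp_prob p (fun E : {set 'I_n * 'I_n} =>
    Rle (Rdiv (Rmult (INR n) (ln (Rinv p))) (Rmult (IZR 80) (ln (INR n)))) (INR (minrank F E))) <= 1.
Proof.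
move=> n3 hp p1.
have n0 : (0 < n)%N by apply: leq_trans n3.
have nR : Rlt (IZR 1) (INR n) by apply: (lt_INR 1); apply/ssrnat.ltP; apply: leq_trans n3.
have p0 : Rle (IZR 0) p.
  apply: Rle_trans hp; apply: Rlt_le; apply: Rinv_0_lt_compat.
  by apply: Rlt_trans nR; apply: Rlt_0_1.
have p01 : 0 <= p <= 1 by apply/andP; split; apply/RleP.
pose B := [set i : 'I_(n * n).+1 * {set 'I_n * 'I_n} |
   [&& (0 < i.1)%N, i.2 \in patterns F n i.1 & p ^+ #|under i.2| <= n%:R^-1 ^+ (19 * i.1)]].
set P := (X in gnp_prob p X).
(* A graph violating the bound contains the edges forced by a pattern from [sparse_pattern];
   [pattern_weight] places this pattern in [B]. *)
have bad (E : {set 'I_n * 'I_n}) : E \subset pairs n -> ~ P E -> exists2 i, i \in B & under i.2 \subset E.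
  move=> EP /Rnot_le_lt nP.
  have [M fM rM] := minrankP F E.
  have [N [T [k [Tpat Tadj mN Nn [Nm kn]]]]] := sparse_pattern n0 fM.
  rewrite rM in kn.
  have Nlt : (N < (n * n).+1)%N by [].
  exists (Ordinal Nlt, T); last exact: under_subset.
  rewrite inE /= Tpat; move: (mN) => /andP [m0 mN']; rewrite (leq_trans m0 mN') /=.
  apply/RleP; rewrite -!RpowE -INRE.
  exact: (@pattern_weight p (INR n) n _ k _ _ (#|under T|) N nR erefl hp p1 nP mN Nm kn (card_le_under T)).
have := gnp_prob_union_bound (D := fun i => under i.2) p01 _ bad.
move=> /(_ _)/andP []; first by move=> i; apply/subsetP => e; rewrite inE => /andP [].
move=> lo ->; rewrite andbT; apply: le_trans lo; rewrite lerD2l lerN2.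
by apply: sum_patterns_weight => //; case/andP: p01.
Qed.

Theorem theorem1p1 (F : nat -> fieldType) (p : nat -> R)
  (hp : forall n : nat, (1 <= n)%N ->
          Rle (Rinv (INR n)) (p n) /\ Rle (p n) (IZR 1)) :
  Un_cv (fun n : nat =>
           @gnp_prob n (p n)
             (fun E => Rle (Rdiv (Rmult (INR n) (ln (Rinv (p n))))
                                 (Rmult (IZR 80) (ln (INR n))))
                           (INR (minrank (F n) E))))
        (IZR 1).
Proof.
move=> eps /archimed_cor1 [N0 [epsN N0pos]].
(* The failure probability is at most 1/n for n >= 3, and 1/n <= 1/N0 < eps. *)
exists (maxn 3 N0) => n /ssrnat.leP; rewrite geq_max => /andP [n3 nN].
have [hp0 hp1] := hp n (leq_trans (isT : 0 < 3)%N n3).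
have /andP [lo hi] := gnp_prob_minrank (F n) n3 hp0 hp1.
apply: Rle_lt_trans epsN; rewrite /R_dist.
have inv : Rle (Rinv (INR n)) (Rinv (INR N0)).
  by apply: Rinv_le_contravar; [apply: (lt_INR 0)|apply: le_INR; apply/ssrnat.leP].
apply: Rle_trans inv; move: lo hi => /RleP lo /RleP hi.
rewrite Rabs_minus_sym Rabs_pos_eq; last by apply: Rge_le; apply: Rge_minus; apply: Rle_ge.
rewrite -INRE in lo.
move: lo; set g := gnp_prob _ _; set x := Rinv _ => lo.
have : Rle (Rminus (IZR 1) x) g by [].
by move=> {}lo; lra.
Qed.
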